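(* Let $n\ge 2$, let $p\in\mathbb{Q}$, and let $x_1=a_1+b_1\sqrt{p},\dots,x_n=a_n+b_n\sqrt{p}$ be real numbers with $a_i,b_i\in\mathbb{Q}$ and $x_i>0$ for $1\le i\le n$, such that $\frac{x_i}{x_j}\notin\mathbb{Q}$ and $x_ix_j\notin\mathbb{Q}$ for all $i\neq j$. Let $z>0$ be real. Then: 1) If there exist $i,j$ with $1\le i,j\le n$ and $(a_i-b_i\sqrt{p})(a_j-b_j\sqrt{p})<0$, then a rectangle with side ratio $z$ can be diversely tiled by rectangles with side ratios $x_1,\dots,x_n$ if and only if $z\in\{e+f\sqrt{p}>0 \mid e,f\in\mathbb{Q}\}$. 2) If $a_i-b_i\sqrt{p}>0$ for all $1\le i\le n$, then a rectangle with side ratio $z$ can be diversely tiled by rectangles with side ratios $x_1,\dots,x_n$ if and only if $$z\in\Big\{e+f\sqrt{p}>0 \;\Big|\; e,f\in\mathbb{Q},\ e>0,\ \frac{|f|}{e}<\max_{i}\frac{|b_i|}{a_i}\Big\}.$$ 3) If $a_i-b_i\sqrt{p}<0$ for all $1\le i\le n$, then a rectangle with side ratio $z$ can be diversely tiled by rectangles with side ratios $x_1,\dots,x_n$ if and only if $$z\in\Big\{e+f\sqrt{p}>0 \;\Big|\; e,f\in\mathbb{Q},\ f>0,\ \frac{|e|}{f}<\max_{i}\frac{|a_i|}{b_i}\Big\}.$$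
   Context: A rectangle has side ratio $x$ if the lengths of its two sides are in ratio $x$ (i.e. it is similar to a $1\times x$ rectangle, in either orientation); the rectangle with side ratio $z$ may be taken to be $1\times z$. A tiling (cutting) of a rectangle into rectangles with side ratios $x_1,\dots,x_n$ is a decomposition of it into finitely many axis-parallel rectangles with pairwise disjoint interiors whose union is the whole rectangle, each piece having side ratio equal to one of $x_1,\dots,x_n$. Such a tiling is called diverse if for every $i=1,\dots,n$ at least one piece of the tiling has side ratio $x_i$. *)

(* Defs.v *)
From mathcomp Require Import all_boot all_order all_algebra.
From mathcomp Require Import all_classical all_reals all_analysis.
Set Implicit Arguments.
Unset Strict Implicit.
Unset Printing Implicit Defensive.
Import Order.TTheory GRing.Theory Num.Theory numFieldNormedType.Exports.
Local Open Scope classical_set_scope.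
Local Open Scope ring_scope.

Record rect (R : realType) := Rect {
  rleft : R;
  rright : R;
  rbottom : R;
  rtop : R;
  rect_width_gt0 : rleft < rright;
  rect_height_gt0 : rbottom < rtop }.

Definition width (R : realType) (Q : rect R) : R := rright Q - rleft Q.

Definition height (R : realType) (Q : rect R) : R := rtop Q - rbottom Q.

Definition region (R : realType) (Q : rect R) : set (R * R) :=
  `[rleft Q, rright Q] `*` `[rbottom Q, rtop Q].

Definition side_ratio (R : realType) (Q : rect R) (x : R) : Prop :=
  width Q / height Q = x \/ height Q / width Q = x.

(* Since rectangles are nondegenerate, disjointness of the interiors also
   rules out repetitions in the family T. *)
Definition tiling (R : realType) (Q : rect R) (m : nat) (T : 'I_m -> rect R) :
    Prop :=
  \bigcup_k region (T k) = region Q /\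
  trivIset [set: 'I_m] (fun k => (region (T k))°).

Definition diversely_tileable (R : realType) (n : nat) (x : 'I_n -> R)
    (Q : rect R) : Prop :=
  exists (m : nat) (T : 'I_m -> rect R),
    [/\ tiling Q T,
        forall k, exists i, side_ratio (T k) (x i) &
        forall i, exists k, side_ratio (T k) (x i)].

(* Main.v *)
(* Necessity.  For arbitrary functions F and G, the quantity
   (F(right) - F(left)) (G(top) - G(bottom)) is additive over tilings.  Write
   s for the square root of p.  Taking for F and G the same Q(s)-linear
   functional psi, every piece contributes x psi(u)^2 >= 0 for one of its sides
   u, whereas psi can be chosen to be 1 and -1 on the sides of Q if their ratio
   is not in Q(s); hence the ratio z lies in Q(s).  If all conjugates x'_i have
   the same sign eps, let psi instead be semilinear for the conjugation s |-> -s
   and normalized by psi(u) = u on one side u of Q.  A suitable combination of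
   w h, psi(w) psi(h), w psi(h) and psi(w) h then vanishes on Q, and is a
   positive form on every piece unless x_i x'_i / (x_i + x'_i)^2 is small
   compared with the same quantity for z; this is the bound in the theorem.
   It is strict because the values |b_i| / a_i are pairwise distinct.

   Sufficiency.  The ratios which can be cut are closed under addition,
   inversion and multiplication by positive rationals.  Since x_i x'_i is
   rational, x'_i (up to sign) can be cut whenever x_i can, and the positive
   rational combinations of x_i and x'_i fill the required cone.  In the
   indefinite case this gives 1 and s, hence all e + f s > 0, again by inverting
   conjugates.  Diversity is obtained by splitting off a small rational multiple
   of the sum of all x_i. *)

Require Import Defs.
From mathcomp Require Import all_boot all_order all_algebra.
From mathcomp Require Import all_classical all_reals all_analysis.
From mathcomp Require Import ring lra.
Set Implicit Arguments.
Unset Strict Implicit.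
Unset Printing Implicit Defensive.
Import Order.TTheory GRing.Theory Num.Theory numFieldNormedType.Exports.
Local Open Scope classical_set_scope.
Local Open Scope ring_scope.

(** * Additivity over tilings *)

Lemma interior_region (R : realType) (Q : rect R) :
  (region Q)° = `]rleft Q, rright Q[ `*` `]rbottom Q, rtop Q[.
Proof.
apply/seteqP; split => [[u v]|[u v] [/= ulr vbt]].
- case=> -[A B] [/= nA nB] ABQ.
  have Au : A u by exact: nbhs_singleton.
  have Bv : B v by exact: nbhs_singleton.
  split => /=.
  + suff: `[rleft Q, rright Q]° u by rewrite interior_itv_bnd.
    by apply: filterS nA => y Ay; have [] := ABQ (y, v) (conj Ay Bv).
  + suff: `[rbottom Q, rtop Q]° v by rewrite interior_itv_bnd.
    by apply: filterS nB => y By; have [] := ABQ (u, y) (conj Au By).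
- exists (`]rleft Q, rright Q[%classic, `]rbottom Q, rtop Q[%classic) => /=.
    by split; apply: near_in_itvoo.
  by move=> [y z] [/= ylr zbt]; split; apply: subset_itv_oo_cc.
Qed.

(** Half-open boxes of a tiling share no boundary points, so their indicators add up exactly,
    without correction on the edges. *)
Definition inbox (R : realType) (Q : rect R) (u v : R) : bool :=
  (rleft Q < u <= rright Q) && (rbottom Q < v <= rtop Q).

Lemma pred_gap (R : realType) (u : R) (L : seq R) :
  exists2 e, 0 < e & forall c, c \in L -> c < u -> c + e < u.
Proof.
elim: L => [|c L [e e0 IH]]; first by exists 1.
exists (if c < u then Num.min e ((u - c) / 2) else e).
  by case: ifPn => // cu; rewrite lt_min e0 divr_gt0// subr_gt0.
move=> d; rewrite inE => /orP[/eqP->|dL] du.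
  rewrite du; have : Num.min e ((u - c) / 2) <= (u - c) / 2.
    by rewrite ge_min lexx orbT.
  by lra.
case: ifPn => cu; last exact: IH.
apply: le_lt_trans (IH _ dL du); rewrite lerD2l.
by rewrite ge_min lexx.
Qed.

(* Just below and to the left of (u, v) lies a point that meets the closed
   boxes, and the open boxes, exactly when (u, v) meets the half-open ones. *)
Lemma tiling_half_open (R : realType) (Q : rect R) (m : nat)
    (T : 'I_m -> rect R) (u v : R) :
  tiling Q T -> \sum_k (inbox (T k) u v)%:R = (inbox Q u v)%:R :> R.
Proof.
move=> [cover disj].
have sub k : [/\ rleft Q <= rleft (T k), rright (T k) <= rright Q,
    rbottom Q <= rbottom (T k) & rtop (T k) <= rtop Q].
  have sub w : region (T k) w -> region Q w.
    by move=> ?; rewrite -cover; exists k.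
  have [wT hT] := (rect_width_gt0 (T k), rect_height_gt0 (T k)).
  have [|/=] := sub (rleft (T k), rbottom (T k)).
    by split; rewrite /= in_itv /= lexx ltW.
  rewrite !in_itv /= => /andP[-> _] /andP[-> _].
  have [|/=] := sub (rright (T k), rtop (T k)).
    by split; rewrite /= in_itv /= lexx ltW.
  by rewrite !in_itv /= => /andP[_ ->] /andP[_ ->].
have [e1 e1_gt0 gap1] := pred_gap u (rleft Q ::
  codom (fun k => rleft (T k)) ++ codom (fun k => rright (T k))).
have [e2 e2_gt0 gap2] := pred_gap v (rbottom Q ::
  codom (fun k => rbottom (T k)) ++ codom (fun k => rtop (T k))).
pose e := Num.min e1 e2.
have e_gt0 : 0 < e by rewrite lt_min e1_gt0.
have ee1 : e <= e1 by rewrite ge_min lexx.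
have ee2 : e <= e2 by rewrite ge_min lexx orbT.
have gl k : rleft (T k) < u -> rleft (T k) < u - e.
  move=> /gap1; rewrite inE mem_cat codom_f orbT => /(_ isT); lra.
have gr k : rright (T k) < u -> rright (T k) < u - e.
  move=> /gap1; rewrite inE mem_cat codom_f !orbT => /(_ isT); lra.
have gb k : rbottom (T k) < v -> rbottom (T k) < v - e.
  move=> /gap2; rewrite inE mem_cat codom_f orbT => /(_ isT); lra.
have gt k : rtop (T k) < v -> rtop (T k) < v - e.
  move=> /gap2; rewrite inE mem_cat codom_f !orbT => /(_ isT); lra.
have gQ1 : rleft Q < u -> rleft Q < u - e.
  by move=> /gap1; rewrite inE eqxx => /(_ isT); lra.
have gQ2 : rbottom Q < v -> rbottom Q < v - e.
  by move=> /gap2; rewrite inE eqxx => /(_ isT); lra.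
have sing k : inbox (T k) u v -> (region (T k))° (u - e, v - e).
  move=> /andP[/andP[lu ur] /andP[bv vt]]; rewrite interior_region.
  have := gl k lu; have := gb k bv.
  by split; rewrite /= in_itv /=; apply/andP; split => //; lra.
have [inQ|ninQ] := boolP (inbox Q u v); last first.
  rewrite big1 // => k _; apply/eqP; rewrite pnatr_eq0 eqb0.
  apply: contra ninQ => /andP[/andP[lu ur] /andP[bv vt]].
  have [? ? ? ?] := sub k.
  by apply/andP; split; apply/andP; split; lra.
have : region Q (u - e, v - e).
  move: inQ => /andP[/andP[lu ur] /andP[bv vt]].
  have := gQ1 lu; have := gQ2 bv.
  by split; rewrite /= in_itv /=; apply/andP; split; lra.
(* A closed tile contains the shifted point. No right or top side lies strictly between that point
   and (u, v), so the half-open tile contains (u, v). *)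
rewrite -cover => -[k _ [/= +]]; rewrite !in_itv /=.
move=> /andP[lu ur] /andP[bv vt].
have ink : inbox (T k) u v.
  apply/andP; split; apply/andP; split; rewrite ?(lt_le_trans lu) //; try lra.
  - by rewrite leNgt; apply/negP => /gr; lra.
  - by rewrite leNgt; apply/negP => /gt; lra.
rewrite (bigD1 k) //= ink big1 ?addr0 // => j jk.
apply/eqP; rewrite pnatr_eq0 eqb0; apply: contraNN jk => inj.
apply/eqP; apply: disj => //.
by exists (u - e, v - e); split; exact: sing.
Qed.

(** Telescoping: [nth 0 (y :: s) i] is the entry just before [nth 0 s i], and the indicator stops
    the sum at [r]. *)
Lemma path_increment_sum (R : realType) (F : R -> R) (y r : R) (s : seq R) :
  path <%R y s -> r \in y :: s ->
  F r - F y = \sum_(i < size s)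
    (F (nth 0 s i) - F (nth 0 (y :: s) i)) * (nth 0 s i <= r)%R%:R.
Proof.
elim: s y => [|c s IH] y /=.
  by rewrite inE big_ord0 => _ /eqP->; rewrite subrr.
move=> /andP[yc cs]; rewrite in_cons => /orP[/eqP->|rs].
  rewrite subrr big1 // => i _.
  have /(_ (nth 0 (c :: s) i)) : forall d, d \in c :: s -> y < d.
    move=> d; apply/allP; rewrite /= yc /=.
    apply: order_path_min; first exact: lt_trans.
    by case: (s) cs => //= d' s' /andP[cd ->]; rewrite (lt_trans yc cd).
  by rewrite mem_nth // => /(_ isT); rewrite ltNge => /negbTE ->; rewrite mulr0.
rewrite big_ord_recl /= -IH //.
have -> : c <= r.
  move: rs; rewrite inE => /orP[/eqP-> //|rs].
  by rewrite ltW //; move: rs; apply/allP/order_path_min => //; exact: lt_trans.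
by rewrite mulr1; lra.
Qed.

(** On finitely many coordinates any function behaves like a step function. The jump points [c]
    depend on [L] alone, so one grid serves all tiles at once. *)
Lemma increment_sum (R : realType) (L : seq R) :
  exists (N : nat) (c : 'I_N -> R) (d : (R -> R) -> 'I_N -> R),
  forall (F : R -> R) (l r : R), l \in L -> r \in L -> l < r ->
  F r - F l = \sum_i d F i * (l < c i <= r)%R%:R.
Proof.
case E : (sort <=%R (undup L)) => [|y s].
  exists 0, (fun=> 0), (fun _ _ => 0) => F l r lL.
  by move: (mem_sort <=%R (undup L) l); rewrite E mem_undup lL.
exists (size s), (nth 0 s), (fun F i => F (nth 0 s i) - F (nth 0 (y :: s) i)).
move=> F l r lL rL lr.
have ys : path <%R y s.
  have := sort_lt_sorted (undup L).
  by rewrite undup_uniq E.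
have mem t : t \in L -> t \in y :: s by rewrite -E mem_sort mem_undup.
rewrite -[LHS](subrKA (F y)) -[F y - F l]opprB.
rewrite (path_increment_sum F ys (mem _ rL)) (path_increment_sum F ys (mem _ lL)).
rewrite -sumrB; apply: eq_bigr => i _; rewrite -mulrBr; congr (_ * _).
case: (leP (nth 0 s i) l) => [il|il] /=; last by rewrite subr0.
by rewrite (le_trans il (ltW lr)) subrr.
Qed.

Lemma tiling_additive (R : realType) (Q : rect R) (m : nat)
    (T : 'I_m -> rect R) (F G : R -> R) :
  tiling Q T ->
  \sum_k (F (rright (T k)) - F (rleft (T k))) *
         (G (rtop (T k)) - G (rbottom (T k))) =
  (F (rright Q) - F (rleft Q)) * (G (rtop Q) - G (rbottom Q)).
Proof.
move=> tQ.
pose L := [:: rleft Q, rright Q &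
  codom (fun k => rleft (T k)) ++ codom (fun k => rright (T k))].
pose L' := [:: rbottom Q, rtop Q &
  codom (fun k => rbottom (T k)) ++ codom (fun k => rtop (T k))].
have [N [c [d Fsum]]] := increment_sum L.
have [M [c' [d' Gsum]]] := increment_sum L'.
(* The product of increments becomes a weighted count of grid points in the half-open box, with
   weights independent of the box. *)
have expand P : rleft P \in L -> rright P \in L ->
    rbottom P \in L' -> rtop P \in L' ->
  (F (rright P) - F (rleft P)) * (G (rtop P) - G (rbottom P)) =
  \sum_i \sum_j d F i * d' G j * (inbox P (c i) (c' j))%:R.
  move=> lP rP bP tP.
  rewrite (Fsum F _ _ lP rP (rect_width_gt0 P)).
  rewrite (Gsum G _ _ bP tP (rect_height_gt0 P)) mulr_suml.
  apply: eq_bigr => i _; rewrite mulr_sumr; apply: eq_bigr => j _.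
  by rewrite mulrACA -natrM mulnb.
rewrite (expand Q) ?inE ?eqxx ?orbT //.
have expandT k : _ := expand (T k).
under eq_bigr => k _ do rewrite expandT ?inE ?mem_cat ?codom_f ?orbT //.
rewrite exchange_big /=; apply: eq_bigr => i _.
rewrite exchange_big /=; apply: eq_bigr => j _.
by rewrite -mulr_sumr (tiling_half_open _ _ tQ).
Qed.

(** * Semilinear functionals *)

(** An element of Q(s) is kept as its pair of coordinates; conjugating it means evaluating the same
    pair at [- s]. *)
Definition qs (R : realType) (s : R) (k : rat * rat) : R :=
  ratr k.1 + ratr k.2 * s.

Lemma qs0 (R : realType) (s : R) : qs s 0 = 0.
Proof. by rewrite /qs /= rmorph0 mul0r addr0. Qed.

Lemma qs1 (R : realType) (s : R) : qs s (1, 0) = 1.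
Proof. by rewrite /qs /= rmorph1 rmorph0 mul0r addr0. Qed.

Lemma qsD (R : realType) (s : R) (k l : rat * rat) :
  qs s (k + l) = qs s k + qs s l.
Proof. by rewrite /qs /= !rmorphD /=; ring. Qed.

Lemma qsN (R : realType) (s : R) (k : rat * rat) : qs s (- k) = - qs s k.
Proof. by rewrite /qs /= !rmorphN /=; ring. Qed.

(** The product pair depends only on [p], hence is the same for both roots. *)
Lemma qsM (R : realType) (p : rat) (s : R) (k l : rat * rat) :
  s ^+ 2 = ratr p ->
  qs s k * qs s l =
  qs s (k.1 * l.1 + p * (k.2 * l.2), k.1 * l.2 + k.2 * l.1).
Proof. by move=> sp; rewrite /qs /= !rmorphD !rmorphM /= -sp; ring. Qed.

Lemma qs_eq0 (R : realType) (s : R) (k : rat * rat) :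
  irrational s -> (qs s k == 0) = (k == 0).
Proof.
move=> irr; apply/eqP/eqP => [|->]; last by rewrite qs0.
case: k => e f; rewrite /qs /= => /eqP; have [->|f0] := eqVneq f 0.
  by rewrite rmorph0 mul0r addr0 fmorph_eq0 => /eqP ->.
rewrite addr_eq0 => /eqP ef; case: irr; exists (- (e / f)) => //.
by rewrite rmorphN fmorph_div /= ef mulNr opprK mulrAC divff ?mul1r// fmorph_eq0.
Qed.

Lemma qs_inv (R : realType) (p : rat) (s : R) (k : rat * rat) :
  irrational s -> s ^+ 2 = ratr p -> k != 0 -> exists l, (qs s k)^-1 = qs s l.
Proof.
move=> irr sp k0.
(* The norm of [k]; the inverse is the conjugate divided by it. *)
pose N := k.1 ^+ 2 - p * k.2 ^+ 2.
have kk : qs s k * qs s (k.1, - k.2) = ratr N.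
  by rewrite /N /qs /= rmorphB rmorphXn rmorphM rmorphXn rmorphN /= -sp; ring.
have N0 : ratr N != 0 :> R.
  rewrite -kk mulf_neq0 ?qs_eq0//; apply: contraNneq k0.
  by case: k {N kk} => e f /= [-> /eqP]; rewrite oppr_eq0 => /eqP ->.
exists (k.1 / N, - k.2 / N); apply: (mulfI (x := qs s k)).
  by rewrite qs_eq0.
rewrite divff ?qs_eq0// -(divff N0) -{1}kk /qs /= !fmorph_div rmorphN /=.
by rewrite -mulrA; congr (_ * _); ring.
Qed.

(* V is a Q(s)-subspace, and Q(s) acts on the values of psi through the
   embedding that sends s to tau. *)
Definition semilinear_on (R : realType) (s tau : R) (V : set R) (psi : R -> R) :=
  [/\ V 0,
      forall u v, V u -> V v -> V (u + v) /\ psi (u + v) = psi u + psi v &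
      forall k u, V u -> V (qs s k * u) /\ psi (qs s k * u) = qs tau k * psi u].

Lemma semilinear_onB (R : realType) (s tau : R) (V : set R) (psi : R -> R) u v :
  semilinear_on s tau V psi -> V u -> V v ->
  V (u - v) /\ psi (u - v) = psi u - psi v.
Proof.
case=> _ VD VZ Vu Vv.
have N1 (t : R) : qs t (-1, 0) = - 1.
  by rewrite /qs /= rmorphN rmorph1 rmorph0 mul0r addr0.
have [] := VZ (-1, 0) v Vv; rewrite !N1 !mulN1r => VNv psiN.
by have [? ->] := VD u (- v) Vu VNv; rewrite psiN.
Qed.

Lemma semilinear_extend1 (R : realType) (p : rat) (s tau : R) (V : set R)
    (psi : R -> R) (u y : R) :
  irrational s -> s ^+ 2 = ratr p -> tau ^+ 2 = ratr p ->
  semilinear_on s tau V psi ->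
  exists V' psi', [/\ semilinear_on s tau V' psi',
    forall v, V v -> V' v /\ psi' v = psi v, V' u & ~ V u -> psi' u = y].
Proof.
move=> irr sp taup lin; have [Vu|nVu] := pselect (V u).
  by exists V, psi; split.
have [V0 VD VZ] := lin.
have psi0 : psi 0 = 0 by have [_] := VZ 0 0 V0; rewrite !qs0 !mul0r.
(* The possible coefficients of [u] in [t]. There is at most one: the difference of two would be
   invertible and would put [u] in [V]. *)
pose P t := [set k | V (t - qs s k * u)].
pose psi' t := psi (t - qs s (xget 0 (P t)) * u) + qs tau (xget 0 (P t)) * y.
have psi'E t k : P t k -> psi' t = psi (t - qs s k * u) + qs tau k * y.
  move=> Ptk; rewrite /psi' (xget_unique (x := k) _ Ptk)// => l Ptl.
  apply/eqP; rewrite -subr_eq0; apply/negPn/negP => lk0.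
  have [l' l'E] := qs_inv irr sp lk0; apply: nVu.
  have [+ _] := semilinear_onB lin Ptk Ptl.
  have -> : t - qs s k * u - (t - qs s l * u) = qs s (l - k) * u.
    by rewrite qsD qsN; ring.
  move=> /(VZ l')[+ _].
  by rewrite mulrA -l'E mulVf ?qs_eq0// mul1r.
exists [set t | exists k, P t k], psi'; split.
- split.
  + by exists 0; rewrite /P /= qs0 mul0r subr0.
  + move=> v w [k Pk] [l Pl].
    have E : v + w - qs s (k + l) * u = (v - qs s k * u) + (w - qs s l * u).
      by rewrite qsD; ring.
    have [VDkl psiD] := VD _ _ Pk Pl.
    have Pkl : P (v + w) (k + l) by rewrite /P /= E.
    split; first by exists (k + l).
    by rewrite (psi'E _ _ Pkl) (psi'E _ _ Pk) (psi'E _ _ Pl) E psiD qsD; ring.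
  + move=> k v [l Pl].
    pose kl := (k.1 * l.1 + p * (k.2 * l.2), k.1 * l.2 + k.2 * l.1).
    have E : qs s k * v - qs s kl * u = qs s k * (v - qs s l * u).
      by rewrite -(qsM _ _ sp); ring.
    have [VZl psiZ] := VZ k _ Pl.
    have Pkl : P (qs s k * v) kl by rewrite /P /= E.
    split; first by exists kl.
    by rewrite (psi'E _ _ Pkl) (psi'E _ _ Pl) E psiZ -(qsM _ _ taup); ring.
- move=> v Vv; have Pv : P v 0 by rewrite /P /= qs0 mul0r subr0.
  by split; [exists 0|rewrite (psi'E _ _ Pv) !qs0 !mul0r subr0 addr0].
- by exists (1, 0); rewrite /P /= qs1 mul1r subrr.
- move=> _; have Pu : P u (1, 0) by rewrite /P /= qs1 mul1r subrr.
  by rewrite (psi'E _ _ Pu) !qs1 !mul1r subrr psi0 add0r.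
Qed.

(** A tiling has finitely many coordinates, so adjoining one vector at a time reaches a large enough
    domain. *)
Lemma semilinear_extend (R : realType) (p : rat) (s tau : R) (V : set R)
    (psi : R -> R) (L : seq R) :
  irrational s -> s ^+ 2 = ratr p -> tau ^+ 2 = ratr p ->
  semilinear_on s tau V psi ->
  exists V' psi', [/\ semilinear_on s tau V' psi',
    forall v, V v -> V' v /\ psi' v = psi v & forall v, v \in L -> V' v].
Proof.
move=> irr sp taup; elim: L V psi => [|u L IH] V psi lin.
  by exists V, psi; split.
have [V1 [psi1 [lin1 ext1 V1u _]]] := semilinear_extend1 u 0 irr sp taup lin.
have [V2 [psi2 [lin2 ext2 V2L]]] := IH _ _ lin1.
exists V2, psi2; split => // v.
  move=> /ext1[/ext2[V2v E2] E1]; split => //; by rewrite E2 E1.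
by rewrite inE => /orP[/eqP->|/V2L//]; have [] := ext2 u V1u.
Qed.

Lemma semilinear_exists (R : realType) (p : rat) (s tau : R)
    (H W y0 y : R) (L : seq R) :
  irrational s -> s ^+ 2 = ratr p -> tau ^+ 2 = ratr p -> H != 0 ->
  exists V psi, [/\ semilinear_on s tau V psi, forall v, v \in L -> V v,
    V H /\ V W, psi H = y0 & (exists k, W = qs s k * H) \/ psi W = y].
Proof.
move=> irr sp taup H0.
have lin0 : semilinear_on s tau [set 0] (fun=> 0).
  by split => [//|_ _ -> ->|k _ ->] /=; rewrite ?(addr0, mulr0).
have [V1 [psi1 [lin1 _ V1H]]] := semilinear_extend1 H y0 irr sp taup lin0.
move=> /(_ (elimN eqP H0)) psi1H.
(* The domain is cut down to the line through [H], so that [W] lies outside it exactly when W / H is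
   not in Q(s). *)
pose V1' := [set v | exists k, v = qs s k * H].
have lin1' : semilinear_on s tau V1' psi1.
  have [_ VD VZ] := lin1; split.
  - by exists 0; rewrite qs0 mul0r.
  - move=> _ _ [k ->] [l ->]; split; first by exists (k + l); rewrite qsD; ring.
    by have [] := VD _ _ (VZ k H V1H).1 (VZ l H V1H).1.
  - move=> k _ [l ->]; split; last by have [] := VZ k _ (VZ l H V1H).1.
    by rewrite mulrA (qsM _ _ sp); eexists.
have V1'H : V1' H.
  by exists (1, 0); rewrite qs1 mul1r.
have [V2 [psi2 [lin2 ext2 V2W psi2W]]] :=
  semilinear_extend1 W y irr sp taup lin1'.
have [V3 [psi3 [lin3 ext3 V3L]]] := semilinear_extend L irr sp taup lin2.
have [V2H psi2H] := ext2 H V1'H.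
have [V3H psi3H] := ext3 H V2H; have [V3W psi3W] := ext3 W V2W.
exists V3, psi3; split => //; first by rewrite psi3H psi2H.
have [?|nW] := pselect (V1' W); first by left.
by right; rewrite psi3W psi2W.
Qed.

(** * Obstructions to tilings *)

Definition coords (R : realType) (P : rect R) : seq R :=
  [:: rleft P; rright P; rbottom P; rtop P].

Definition tiling_coords (R : realType) (Q : rect R) (m : nat)
    (T : 'I_m -> rect R) : seq R :=
  coords Q ++ flatten (codom (fun k => coords (T k))).

Lemma width_gt0 (R : realType) (P : rect R) : 0 < width P.
Proof. by rewrite subr_gt0 rect_width_gt0. Qed.

Lemma height_gt0 (R : realType) (P : rect R) : 0 < height P.
Proof. by rewrite subr_gt0 rect_height_gt0. Qed.

Lemma side_ratioE (R : realType) (P : rect R) (x : R) :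
  side_ratio P x <-> width P = x * height P \/ height P = x * width P.
Proof.
have [w0 h0] := (lt0r_neq0 (width_gt0 P), lt0r_neq0 (height_gt0 P)).
split=> -[].
- by move=> <-; left; rewrite divfK.
- by move=> <-; right; rewrite divfK.
- by move=> E; left; rewrite E mulfK.
- by move=> E; right; rewrite E mulfK.
Qed.

Lemma side_ratio_gt0 (R : realType) (P : rect R) (x : R) :
  side_ratio P x -> 0 < x.
Proof. by case=> <-; rewrite divr_gt0 ?width_gt0 ?height_gt0. Qed.

Lemma semilinear_sides (R : realType) (s tau : R) (V : set R) (psi : R -> R)
    (P : rect R) :
  semilinear_on s tau V psi -> (forall c, c \in coords P -> V c) ->
  [/\ V (width P), V (height P), psi (rright P) - psi (rleft P) = psi (width P) &
      psi (rtop P) - psi (rbottom P) = psi (height P)].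
Proof.
move=> lin VP.
have [Vl Vr Vb Vt] :
    [/\ V (rleft P), V (rright P), V (rbottom P) & V (rtop P)].
  by split; apply: VP; rewrite !inE eqxx ?orbT.
have [VW psiW] := semilinear_onB lin Vr Vl.
have [VH psiH] := semilinear_onB lin Vt Vb.
by split; rewrite // /width /height ?psiW ?psiH.
Qed.

(** The two functionals may belong to different embeddings; pairing the identity with a
    conjugate-semilinear map gives the mixed products. *)
Lemma tiling_semilinear (R : realType) (s tau tau' : R) (V V' : set R)
    (psi psi' : R -> R) (Q : rect R) (m : nat) (T : 'I_m -> rect R) :
  semilinear_on s tau V psi -> semilinear_on s tau' V' psi' ->
  (forall c, c \in tiling_coords Q T -> V c) ->
  (forall c, c \in tiling_coords Q T -> V' c) ->
  tiling Q T ->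
  \sum_k psi (width (T k)) * psi' (height (T k)) =
  psi (width Q) * psi' (height Q).
Proof.
move=> lin lin' VL V'L /(tiling_additive psi psi').
have inQ c : c \in coords Q -> c \in tiling_coords Q T.
  by rewrite mem_cat => ->.
have inT k c : c \in coords (T k) -> c \in tiling_coords Q T.
  move=> ck; rewrite mem_cat; apply/orP; right.
  by apply/flattenP; exists (coords (T k)); rewrite ?codom_f.
have [_ _ -> _] := semilinear_sides lin (fun c cQ => VL c (inQ c cQ)).
have [_ _ _ ->] := semilinear_sides lin' (fun c cQ => V'L c (inQ c cQ)).
move=> <-; apply: eq_bigr => k _.
have [_ _ -> _] := semilinear_sides lin (fun c ck => VL c (inT k c ck)).
by have [_ _ _ ->] := semilinear_sides lin' (fun c ck => V'L c (inT k c ck)).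
Qed.

Lemma tiling_coords_sides (R : realType) (s tau : R) (V : set R)
    (psi : R -> R) (Q : rect R) (m : nat) (T : 'I_m -> rect R) k :
  semilinear_on s tau V psi ->
  (forall c, c \in tiling_coords Q T -> V c) ->
  V (width (T k)) /\ V (height (T k)).
Proof.
move=> lin VL.
have [|? ? _ _] := @semilinear_sides _ _ _ _ _ (T k) lin; last by split.
move=> c ck; apply: VL; rewrite mem_cat; apply/orP; right.
by apply/flattenP; exists (coords (T k)); rewrite ?codom_f.
Qed.

Lemma tiled_ratio_in_field (R : realType) (p : rat) (s : R)
    (Q : rect R) (m : nat) (T : 'I_m -> rect R) (z : R) :
  irrational s -> s ^+ 2 = ratr p -> tiling Q T -> side_ratio Q z ->
  (forall k, exists l, side_ratio (T k) (qs s l)) -> exists l, z = qs s l.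
Proof.
move=> irr sp tQ Qz TK.
have [w0 h0] := (lt0r_neq0 (width_gt0 Q), lt0r_neq0 (height_gt0 Q)).
suff [l Wl] : exists l, width Q = qs s l * height Q.
  have [<-|<-] := Qz.
    by exists l; rewrite Wl mulfK.
  have l0 : l != 0.
    by apply: contraNneq w0 => l0; rewrite Wl l0 qs0 mul0r.
  have [l' l'E] := qs_inv irr sp l0.
  by exists l'; rewrite -l'E Wl invfM mulrCA divff ?mulr1.
(* For independent sides, [psi] is 1 on the height and -1 on the width, so a sum of nonnegative tile
   terms would equal -1. *)
have [V [psi [lin VL [VH VW] psiH [//|psiW]]]] :=
  semilinear_exists (width Q) 1 (- 1) (tiling_coords Q T) irr sp sp h0.
have := tiling_semilinear lin lin VL VL tQ; rewrite psiH psiW mulr1.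
have [_ _ VZ] := lin.
suff : 0 <= \sum_k psi (width (T k)) * psi (height (T k)).
  by move=> + E; rewrite E ler0N1.
apply: sumr_ge0 => k _; have [l Tl] := TK k.
have x0 := side_ratio_gt0 Tl.
have [Vw Vh] := tiling_coords_sides k lin VL.
have [->|->] := (side_ratioE _ _).1 Tl.
  by rewrite (VZ l _ Vh).2 -mulrA -expr2 mulr_ge0 ?sqr_ge0// ltW.
by rewrite (VZ l _ Vw).2 mulrCA -expr2 mulr_ge0 ?sqr_ge0// ltW.
Qed.

(* The coefficients make the form vanish at x = z, x' = z', d = 1, u = u';
   disc is, up to a positive factor, the opposite of its discriminant. *)
Section PositiveForm.
Variables (R : realType) (x x' z z' d u u' : R).
Hypotheses (x0 : 0 < x) (z0 : 0 < z) (z'0 : 0 < z') (d1 : d ^+ 2 = 1).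
Let form := z' * (z + z') * x * u ^+ 2 + z * (z + z') * x' * u' ^+ 2
  - d * (2 * z * z') * (x + x') * u * u'.
Let disc := (z + z') ^+ 2 * (x * x') - z * z' * (x + x') ^+ 2.

Let form_completed : z' * (z + z') * x * form =
  (z' * (z + z') * x * u - d * (z * z') * (x + x') * u') ^+ 2 +
  z * z' * u' ^+ 2 * disc.
Proof.
(* With d ^+ 2 put back in place of 1, completing the square in [u] is a polynomial identity. *)
have -> : z * z' * u' ^+ 2 * disc =
   z * z' * u' ^+ 2 * ((z + z') ^+ 2 * (x * x') - d ^+ 2 * (z * z' * (x + x') ^+ 2)).
  by rewrite d1 mul1r.
by rewrite /form; ring.
Qed.

Let lead_gt0 : 0 < z' * (z + z') * x.
Proof. by rewrite !mulr_gt0 ?addr_gt0. Qed.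

Lemma form_ge0 : z * z' * (x + x') ^+ 2 <= (z + z') ^+ 2 * (x * x') ->
  0 <= form.
Proof.
move=> D; rewrite -(pmulr_rge0 _ lead_gt0) form_completed.
apply: addr_ge0; first exact: sqr_ge0.
by rewrite mulr_ge0 ?subr_ge0// mulr_ge0 ?sqr_ge0// mulr_ge0// ltW.
Qed.

Lemma form_gt0 : z * z' * (x + x') ^+ 2 < (z + z') ^+ 2 * (x * x') ->
  0 < u -> 0 < form.
Proof.
move=> D u0; rewrite -(pmulr_rgt0 _ lead_gt0) form_completed.
have [->|u'0] := eqVneq u' 0.
  by rewrite !mulr0 subr0 expr0n /= mulr0 mul0r addr0 exprn_gt0// mulr_gt0.
have u'2 : 0 < u' ^+ 2 by rewrite exprn_even_gt0.
by rewrite ltr_wpDl ?sqr_ge0// mulr_gt0 ?subr_gt0// mulr_gt0// mulr_gt0.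
Qed.

End PositiveForm.

(** * Obstruction when all conjugates have the same sign [eps] *)

Section Definite.
Variables (R : realType) (p : rat) (s tau eps : R).
Hypotheses (irr : irrational s) (irr' : irrational tau).
Hypotheses (sp : s ^+ 2 = ratr p) (taup : tau ^+ 2 = ratr p).
Hypothesis (eps1 : eps ^+ 2 = 1).
Variables (n : nat) (c : 'I_n -> rat * rat).
Let x i := qs s (c i).
Let x' i := eps * qs tau (c i).
Hypothesis (x'0 : forall i, 0 < x' i).
Variables (Q : rect R) (m : nat) (T : 'I_m -> rect R) (l : rat * rat).
Let z := qs s l.
Let z' := eps * qs tau l.
Hypotheses (tQ : tiling Q T) (Qz : side_ratio Q z).
Hypothesis (Tx : forall k, exists i, side_ratio (T k) (x i)).

Let epsK (y : R) : eps * (eps * y) = y.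
Proof. by rewrite mulrA -expr2 eps1 mul1r. Qed.

(** Once [psi] fixes one side of [Q], semilinearity forces its value on the other side; the
    disjuncts are the two orientations. *)
Let conj_functional : exists V psi,
  [/\ semilinear_on s tau V psi,
      forall v, v \in tiling_coords Q T -> V v &
      (width Q = z * height Q /\ psi (width Q) = eps * z' * height Q) /\
      psi (height Q) = height Q \/
      (height Q = z * width Q /\ psi (height Q) = eps * z' * width Q) /\
      psi (width Q) = width Q].
Proof.
have [w0 h0] := (lt0r_neq0 (width_gt0 Q), lt0r_neq0 (height_gt0 Q)).
case: ((side_ratioE Q z).1 Qz) => E.
- have [V [psi [lin VL [VH _] psiH _]]] :=
    semilinear_exists (width Q) (height Q) 0 (tiling_coords Q T) irr sp taup h0.
  have [_ _ /(_ l _ VH)[_ psiW]] := lin.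
  exists V, psi; split => //; left; split => //; split => //.
  by rewrite E psiW psiH /z' epsK.
- have [V [psi [lin VL [VH _] psiH _]]] :=
    semilinear_exists (height Q) (width Q) 0 (tiling_coords Q T) irr sp taup w0.
  have [_ _ /(_ l _ VH)[_ psiW]] := lin.
  exists V, psi; split => //; right; split => //; split => //.
  by rewrite E psiW psiH /z' epsK.
Qed.

(** Each tile contributes its positive [x' i] times a square to the sum of eps * psi(w) * psi(h),
    whose total is [z'] times the square of a side of [Q]. Irrationality of [tau] excludes zero. *)
Lemma tiled_conj_gt0 : 0 < z'.
Proof.
have [V [psi [lin VL psiQ]]] := conj_functional.
have z'0 : z' != 0.
  have l0 : l != 0.
    apply: contraTneq (side_ratio_gt0 Qz) => l0.
    by rewrite /z l0 qs0 ltxx.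
  rewrite /z' mulf_neq0 ?qs_eq0//.
  by apply: contraTneq (oner_neq0 R) => e0; rewrite -eps1 e0 expr0n eqxx.
have sum : 0 <= \sum_k eps * (psi (width (T k)) * psi (height (T k))).
  apply: sumr_ge0 => k _; have [i Ti] := Tx k.
  have [Vw Vh] := tiling_coords_sides k lin VL; have [_ _ VZ] := lin.
  have [->|->] := (side_ratioE _ _).1 Ti.
    rewrite (VZ _ _ Vh).2 -[qs tau _]epsK -/(x' i).
    rewrite (_ : eps * _ = eps ^+ 2 * (x' i * psi (height (T k)) ^+ 2)); last ring.
    by rewrite eps1 mul1r mulr_ge0 ?sqr_ge0// ltW.
  rewrite (VZ _ _ Vw).2 -[qs tau _]epsK -/(x' i).
  rewrite (_ : eps * _ = eps ^+ 2 * (x' i * psi (width (T k)) ^+ 2)); last ring.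
  by rewrite eps1 mul1r mulr_ge0 ?sqr_ge0// ltW.
rewrite lt_neqAle eq_sym z'0 /=; move: sum.
rewrite -mulr_sumr (tiling_semilinear lin lin VL VL tQ).
case: psiQ => -[[_ ->] ->].
- rewrite (_ : eps * _ = eps ^+ 2 * (z' * height Q ^+ 2)); last ring.
  by rewrite eps1 mul1r pmulr_lge0// exprn_gt0// height_gt0.
- rewrite (_ : eps * _ = eps ^+ 2 * (z' * width Q ^+ 2)); last ring.
  by rewrite eps1 mul1r pmulr_lge0// exprn_gt0// width_gt0.
Qed.

(** The weights [c3] and [c3 * eps] of the mixed products are matched so that turning a tile only
    multiplies the mixed term by [eps]. *)
Let Form c1 c2 c3 (psi : R -> R) P :=
  c1 * (width P * height P) + c2 * eps * (psi (width P) * psi (height P)) +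
  (c3 * (width P * psi (height P)) + c3 * eps * (psi (width P) * height P)).

Let Form_sum c1 c2 c3 V psi : semilinear_on s tau V psi ->
  (forall v, v \in tiling_coords Q T -> V v) ->
  \sum_k Form c1 c2 c3 psi (T k) = Form c1 c2 c3 psi Q.
Proof.
move=> lin VL; rewrite /Form !big_split /= -!mulr_sumr.
have linid : semilinear_on s s setT id by split.
have setTL c0 : c0 \in tiling_coords Q T -> setT c0 by [].
rewrite (tiling_semilinear lin lin VL VL tQ).
rewrite (tiling_semilinear linid linid setTL setTL tQ).
rewrite (tiling_semilinear linid lin setTL VL tQ).
by rewrite (tiling_semilinear lin linid VL setTL tQ).
Qed.

Let FormE c1 c2 c3 V psi P k : semilinear_on s tau V psi ->
  V (width P) -> V (height P) -> side_ratio P (qs s k) ->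
  exists d u u', [/\ d ^+ 2 = 1, 0 < u &
    Form c1 c2 c3 psi P =
    c1 * qs s k * u ^+ 2 + c2 * (eps * qs tau k) * u' ^+ 2 +
    c3 * d * (qs s k + eps * qs tau k) * u * u'].
Proof.
move=> [_ _ VZ] Vw Vh /side_ratioE[E|E].
- exists 1, (height P), (psi (height P)).
  split; [by rewrite expr1n|exact: height_gt0|].
  by rewrite /Form E (VZ _ _ Vh).2; ring.
- exists eps, (width P), (psi (width P)); split => //; first exact: width_gt0.
  rewrite /Form E (VZ _ _ Vw).2.
  rewrite -{2}[qs tau k]mul1r -eps1.
  by ring.
Qed.

(** Otherwise the form would be nonnegative on every tile and positive on one of ratio [x i0], yet
    its total on [Q] is zero. *)
Lemma tiled_disc (i0 : 'I_n) :
  (exists k, side_ratio (T k) (x i0)) ->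
  z * z' * (x i0 + x' i0) ^+ 2 < (z + z') ^+ 2 * (x i0 * x' i0) ->
  exists i, (z + z') ^+ 2 * (x i * x' i) < z * z' * (x i + x' i) ^+ 2.
Proof.
move=> [k0 Tk0] D0; apply: contrapT => noi.
have D i : z * z' * (x i + x' i) ^+ 2 <= (z + z') ^+ 2 * (x i * x' i).
  by rewrite leNgt; apply/negP => Di; apply: noi; exists i.
have z0 := side_ratio_gt0 Qz; have z'0 := tiled_conj_gt0.
have [V [psi [lin VL psiQ]]] := conj_functional.
pose c1 := z' * (z + z'); pose c2 := z * (z + z').
(* The sign [d] records the orientation of [Q]: 1 if the width is [z] times the height, [eps]
   otherwise. *)
have [c3 [d [d1 c3E FQ]]] : exists c3 d,
    [/\ d ^+ 2 = 1, c3 = - (d * (2 * z * z')) & Form c1 c2 c3 psi Q = 0].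
  case: psiQ => -[[E1 E2] E3].
  - exists (- (1 * (2 * z * z'))), 1; rewrite expr1n; split => //.
    rewrite /Form /c1 /c2 E2 E3 E1 (_ : _ + _ = (eps ^+ 2 - 1) *
      (z * z' * (z - z') * height Q ^+ 2)); last by ring.
    by rewrite eps1 subrr mul0r.
  - exists (- (eps * (2 * z * z'))), eps; split => //.
    rewrite /Form /c1 /c2 E2 E3 E1 (_ : _ + _ = (eps ^+ 2 - 1) *
      (- (z * z' * (z + z') * width Q ^+ 2))); last by ring.
    by rewrite eps1 subrr mul0r.
have F k : exists i u u' e, [/\ e ^+ 2 = 1, 0 < u, side_ratio (T k) (x i) &
    Form c1 c2 c3 psi (T k) = z' * (z + z') * x i * u ^+ 2 +
     z * (z + z') * x' i * u' ^+ 2 - e * (2 * z * z') * (x i + x' i) * u * u'].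
  have [i Ti] := Tx k; have [Vw Vh] := tiling_coords_sides k lin VL.
  have [e [u [u' [e1 u0 E]]]] := FormE c1 c2 c3 lin Vw Vh Ti.
  exists i, u, u', (d * e); split => //; first by rewrite exprMn d1 e1 mulr1.
  by rewrite E c3E /c1 /c2 /x' /x; ring.
have := Form_sum c1 c2 c3 lin VL; rewrite FQ.
suff : 0 < \sum_k Form c1 c2 c3 psi (T k) by move=> /[swap] ->; rewrite ltxx.
rewrite (bigD1 k0) //= ltr_pwDl //.
  have [Vw Vh] := tiling_coords_sides k0 lin VL.
  have [e [u [u' [e1 u0 ->]]]] := FormE c1 c2 c3 lin Vw Vh Tk0.
  have := @form_gt0 R (x i0) (x' i0) z z' (d * e) u u' (side_ratio_gt0 Tk0) z0 z'0.
  rewrite exprMn d1 e1 mulr1 => /(_ erefl D0 u0).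
  by rewrite c3E /c1 /c2 /x' -/(x i0); congr (0 < _); ring.
apply: sumr_ge0 => k _; have [i [u [u' [e [e1 u0 Ti ->]]]]] := F k.
by apply: form_ge0 => //; exact: side_ratio_gt0 Ti.
Qed.

End Definite.

(** * Construction of tilings *)

Lemma tiling_cat (R : realType) (Q Q1 Q2 : rect R) (m1 m2 : nat)
    (T1 : 'I_m1 -> rect R) (T2 : 'I_m2 -> rect R) :
  region Q = region Q1 `|` region Q2 ->
  (region Q1)° `&` (region Q2)° = set0 ->
  tiling Q1 T1 -> tiling Q2 T2 ->
  tiling Q (fun k => match fintype.split k with inl i => T1 i | inr j => T2 j end).
Proof.
move=> QE dis [cov1 dis1] [cov2 dis2]; split.
- rewrite QE -cov1 -cov2; apply/seteqP; split => [w [k _]|w].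
    by case: (fintype.split k) => i Tw; [left|right]; exists i.
  case=> -[i _ Tw].
    by exists (lshift m2 i) => //=; rewrite (unsplitK (inl i)).
  by exists (rshift m1 i) => //=; rewrite (unsplitK (inr i)).
- have sub1 i : (region (T1 i))° `<=` (region Q1)°.
    by apply: interiorS; rewrite -cov1 => w Tw; exists i.
  have sub2 i : (region (T2 i))° `<=` (region Q2)°.
    by apply: interiorS; rewrite -cov2 => w Tw; exists i.
  move=> k k' _ _; rewrite -(splitK k) -(splitK k').
  case: (fintype.split k) => i; case: (fintype.split k') => j; rewrite !unsplitK => -[w [wi wj]].
  + by rewrite (dis1 i j)//; exists w.
  + have : ((region Q1)° `&` (region Q2)°) w by split; [exact: sub1 wi|exact: sub2 wj].
    by rewrite dis.
  + have : ((region Q1)° `&` (region Q2)°) w by split; [exact: sub1 wj|exact: sub2 wi].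
    by rewrite dis.
  + by rewrite (dis2 i j)//; exists w.
Qed.

Lemma tiling1 (R : realType) (Q : rect R) : tiling Q (fun _ : 'I_1 => Q).
Proof.
split; first by rewrite bigcup_const//; exists ord0.
by move=> i j _ _ _; rewrite (ord1 i) (ord1 j).
Qed.

(** [S] lists the ratios that must occur, so diversity can be postponed by taking [S] empty.
    Quantifying over all [Q] lets pieces be cut wherever they lie. *)
Definition cuttable (R : realType) (n : nat) (x : 'I_n -> R) (S : set 'I_n)
    (z : R) : Prop :=
  forall Q, side_ratio Q z -> exists m (T : 'I_m -> rect R),
    [/\ tiling Q T, forall k, exists i, side_ratio (T k) (x i) &
        forall i, S i -> exists k, side_ratio (T k) (x i)].

(** * Closure properties of the ratios that can be cut *)

Section Cuttable.
Variables (R : realType) (n : nat) (x : 'I_n -> R).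
Implicit Types (S : set 'I_n) (z : R).

Lemma cuttable_piece i : cuttable x [set i] (x i).
Proof.
move=> Q Qx; exists 1%N, (fun=> Q); split => [|_|_ ->]; first exact: tiling1.
- by exists i.
- by exists ord0.
Qed.

Lemma cuttableW S S' z : S' `<=` S -> cuttable x S z -> cuttable x S' z.
Proof.
move=> SS' cut Q /cut[m [T [tQ Tx xT]]].
by exists m, T; split => // i /SS' /xT.
Qed.

Lemma cuttableV S z : cuttable x S z -> cuttable x S z^-1.
Proof.
move=> cut Q Qz; apply: cut.
by case: Qz => E; [right|left]; rewrite -[z]invrK -E invf_div.
Qed.

Let cut_union S S' (Q Q1 Q2 : rect R) z z' :
  region Q = region Q1 `|` region Q2 ->
  (region Q1)° `&` (region Q2)° = set0 ->
  side_ratio Q1 z -> side_ratio Q2 z' -> cuttable x S z -> cuttable x S' z' ->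
  exists m (T : 'I_m -> rect R),
    [/\ tiling Q T, forall k, exists i, side_ratio (T k) (x i) &
        forall i, (S `|` S') i -> exists k, side_ratio (T k) (x i)].
Proof.
move=> QE dis Q1z Q2z /(_ _ Q1z)[m1 [T1 [t1 T1x xT1]]].
move=> /(_ _ Q2z)[m2 [T2 [t2 T2x xT2]]].
exists (m1 + m2)%N, (fun k => match fintype.split k with inl i => T1 i | inr j => T2 j end).
split; first exact: tiling_cat t1 t2.
- by move=> k; case: (fintype.split k).
- move=> i [/xT1|/xT2] [k ki].
    by exists (lshift m2 k); rewrite (unsplitK (inl k)).
  by exists (rshift m1 k); rewrite (unsplitK (inr k)).
Qed.

(** One straight cut, at distance [z] times the side parallel to it, leaves pieces of ratios [z] and
    [z']. *)
Lemma cuttableD S S' z z' : 0 < z -> 0 < z' ->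
  cuttable x S z -> cuttable x S' z' -> cuttable x (S `|` S') (z + z').
Proof.
move=> z0 z'0 cut cut' Q /side_ratioE Qz.
have [h0 w0] := (height_gt0 Q, width_gt0 Q).
case: Qz => E.
- have lc : rleft Q < rleft Q + z * height Q by rewrite ltrDl mulr_gt0.
  have cr : rleft Q + z * height Q < rright Q.
    rewrite -ltrBrDl -/(width Q) E ltr_pM2r//; lra.
  pose Q1 := Rect lc (rect_height_gt0 Q); pose Q2 := Rect cr (rect_height_gt0 Q).
  apply: (cut_union (Q1 := Q1) (Q2 := Q2) _ _ _ _ cut cut').
  + apply/seteqP; rewrite /region /Q1 /Q2 /=; split => -[u v] /=; rewrite !in_itv /=.
      case=> /andP[lu ur] ->.
      have [uc|/ltW uc] := leP u (rleft Q + z * height Q); [left|right].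
        by rewrite lu.
      by rewrite uc ur.
    by case=> -[/andP[lu ur] ->]; split => //; apply/andP; split; lra.
  + rewrite !interior_region /Q1 /Q2 /=; apply/seteqP; split => -[u v] //=.
    by rewrite !in_itv /= => -[[/andP[_ uc] _] [/andP[cu _] _]]; lra.
  + by apply/side_ratioE; left; rewrite /width /= /height /=; ring.
  + apply/side_ratioE; left; rewrite /width /=.
    by move: E; rewrite /width /height /= => E; lra.
- have lc : rbottom Q < rbottom Q + z * width Q by rewrite ltrDl mulr_gt0.
  have cr : rbottom Q + z * width Q < rtop Q.
    rewrite -ltrBrDl -/(height Q) E ltr_pM2r//; lra.
  pose Q1 := Rect (rect_width_gt0 Q) lc; pose Q2 := Rect (rect_width_gt0 Q) cr.
  apply: (cut_union (Q1 := Q1) (Q2 := Q2) _ _ _ _ cut cut').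
  + apply/seteqP; rewrite /region /Q1 /Q2 /=; split => -[u v] /=; rewrite !in_itv /=.
      case=> -> /andP[bv vt].
      have [vc|/ltW vc] := leP v (rbottom Q + z * width Q); [left|right].
        by rewrite bv.
      by rewrite vc vt.
    by case=> -[-> /andP[lu ur]]; split => //; apply/andP; split; lra.
  + rewrite !interior_region /Q1 /Q2 /=; apply/seteqP; split => -[u v] //=.
    by rewrite !in_itv /= => -[[_ /andP[_ uc]] [_ /andP[cu _]]]; lra.
  + by apply/side_ratioE; right; rewrite /height /= /width /=; ring.
  + apply/side_ratioE; right; rewrite /height /=.
    by move: E; rewrite /width /height /= => E; lra.
Qed.

Lemma cuttableMn S z m : 0 < z -> cuttable x S z -> cuttable x S (z *+ m.+1).
Proof.
move=> z0 cut; elim: m => [|m IH]; first by rewrite mulr1n.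
rewrite mulrS -[S]setUid; apply: cuttableD => //.
by rewrite pmulrn_lgt0.
Qed.

(** Integer multiples come from repeated addition; division by an integer is multiplication between
    two inversions. *)
Lemma cuttableZ S z (q : rat) : 0 < z -> 0 < q ->
  cuttable x S z -> cuttable x S (ratr q * z).
Proof.
move=> z0 q0 cut.
have [m [d ->]] : exists m d : nat, q = m.+1%:R / d.+1%:R.
  exists `|numq q|.-1, `|denq q|.-1.
  have nq : (0 < `|numq q|)%N by rewrite absz_gt0 numq_eq0 gt_eqF.
  have dq : (0 < `|denq q|)%N by rewrite absz_gt0 denq_eq0.
  rewrite !prednK // !natr_absz (ger0_norm (ltW (denq_gt0 q))).
  by rewrite ger0_norm ?divq_num_den// numq_ge0 ltW.
rewrite fmorph_div /= !ratr_nat.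
have -> : m.+1%:R / d.+1%:R * z = ((z *+ m.+1)^-1 *+ d.+1)^-1.
  by rewrite -[z *+ _]mulr_natl -[_^-1 *+ _]mulr_natl invfM invrK mulrA [_^-1 * _]mulrC.
apply/cuttableV/cuttableMn; first by rewrite invr_gt0 pmulrn_lgt0.
exact/cuttableV/cuttableMn.
Qed.

Lemma cuttable_sum S z (q : rat) (l : seq 'I_n) : 0 < z -> 0 < q ->
  (forall i, 0 < x i) -> cuttable x S z ->
  cuttable x (S `|` [set i | i \in l]) (z + ratr q * \sum_(i <- l) x i).
Proof.
move=> z0 q0 x0 cut; elim: l => [|i l IH].
  rewrite big_nil mulr0 addr0; apply: cuttableW cut.
  by move=> j [|].
rewrite big_cons mulrDr addrCA addrC.
apply: cuttableW; last apply: cuttableD IH (cuttableZ _ _ (cuttable_piece (i:=i))) => //.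
- by move=> j [Sj|]; [by left; left|rewrite /= inE => /orP[/eqP|]; [right|left; right]].
- by rewrite ltr_wpDr// mulr_ge0 ?ler0q ?sumr_ge0// => [|j _]; rewrite ltW.
- by rewrite mulr_gt0 ?ltr0q.
Qed.

(** A strip of ratio [ratr q * \sum_i x i] shows every piece, so the remainder may be cut without
    regard to diversity. *)
Lemma cuttable_diverse S z (q : rat) : 0 < q -> 0 < z - ratr q * \sum_i x i ->
  (forall i, 0 < x i) -> cuttable x S (z - ratr q * \sum_i x i) ->
  cuttable x setT z.
Proof.
move=> q0 z0 x0 cut; have := cuttable_sum (l := index_enum 'I_n) z0 q0 x0 cut.
rewrite subrK; apply: cuttableW => i _.
by right; rewrite /= mem_index_enum.
Qed.

End Cuttable.

Section CuttableField.
Variables (R : realType) (n : nat) (x : 'I_n -> R) (S : set 'I_n).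
Implicit Types (z : R) (q : rat).

(** [z'] is a positive rational multiple of the inverse of [z]. *)
Lemma cuttable_conj z z' q : 0 < z -> 0 < z' -> z * z' = ratr q ->
  cuttable x S z -> cuttable x S z'.
Proof.
move=> z0 z'0 zz' cut.
have q0 : 0 < q by rewrite -(ltr0q R) -zz' mulr_gt0.
have -> : z' = (ratr q^-1 * z)^-1.
  by rewrite fmorphV /= -zz' invfM invrK mulrAC divff ?gt_eqF// mul1r.
by apply/cuttableV/cuttableZ; rewrite ?invr_gt0.
Qed.

Lemma cuttable_comb z z' q q' : 0 < z -> 0 < z' -> 0 <= q -> 0 <= q' ->
  0 < ratr q * z + ratr q' * z' ->
  cuttable x S z -> cuttable x S z' -> cuttable x S (ratr q * z + ratr q' * z').
Proof.
move=> z0 z'0; rewrite !le_eqVlt => /orP[/eqP<-|q0] /orP[/eqP<-|q'0].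
- by rewrite rmorph0 !mul0r addr0 ltxx.
- by rewrite rmorph0 mul0r add0r => _ _; exact: cuttableZ.
- by rewrite rmorph0 mul0r addr0 => _ + _; exact: cuttableZ.
- move=> _ cut cut'; rewrite -[S]setUid.
  by apply: cuttableD (cuttableZ _ _ cut) (cuttableZ _ _ cut') => //;
    rewrite mulr_gt0 ?ltr0q.
Qed.

(** If the coordinates have mixed signs, the conjugate up to sign has nonnegative ones and its
    product with the number is rational. *)
Lemma cuttable_field (p : rat) (s : R) (k : rat * rat) : 0 < s ->
  s ^+ 2 = ratr p -> cuttable x S 1 -> cuttable x S s ->
  0 < qs s k -> cuttable x S (qs s k).
Proof.
move=> s0 sp cut1 cuts; case: k => e f.
have pos q q' : 0 <= q -> 0 <= q' -> 0 < qs s (q, q') -> cuttable x S (qs s (q, q')).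
  by rewrite /qs /= -[ratr q]mulr1 => *; exact: cuttable_comb.
move=> z0; have [e0|e0] := leP 0 e; have [f0|f0] := leP 0 f.
- exact: pos.
- have y0 : 0 < qs s (e, - f).
    apply: lt_trans z0 _; rewrite /qs /= ltrD2l ltr_pM2r// ltr_rat.
    by rewrite (lt_trans f0)// oppr_gt0.
  apply: (cuttable_conj (q := e ^+ 2 - p * f ^+ 2) y0 z0).
    by rewrite /qs /= rmorphB rmorphXn rmorphM rmorphXn rmorphN /= -sp; ring.
  by apply: pos => //; rewrite oppr_ge0 ltW.
- have y0 : 0 < qs s (- e, f).
    apply: lt_trans z0 _; rewrite /qs /= ltrD2r ltr_rat.
    by rewrite (lt_trans e0)// oppr_gt0.
  apply: (cuttable_conj (q := p * f ^+ 2 - e ^+ 2) y0 z0).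
    by rewrite /qs /= rmorphB rmorphXn rmorphM rmorphXn rmorphN /= -sp; ring.
  by apply: pos => //; rewrite oppr_ge0 ltW.
- suff : qs s (e, f) < 0 by rewrite ltNge (ltW z0).
  have fs0 : ratr f * s < 0 by rewrite pmulr_llt0 ?ltrq0.
  by rewrite /qs /= ltr_nDl ?ltrq0.
Qed.

End CuttableField.

Lemma small_ratr (R : realType) (c d u v : R) : 0 < u -> 0 < v ->
  exists q : rat, [/\ 0 < q, ratr q * c < u & ratr q * d < v].
Proof.
move=> u0 v0; pose m := Num.truncn (Num.max (c / u) (d / v)).
exists (m.+1%:R^-1); rewrite fmorphV /= ratr_nat !ltr_pdivrMl ?ltr0n// invr_gt0 ltr0n.
have := truncnS_gt (Num.max (c / u) (d / v)); rewrite gt_max -/m.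
by rewrite !ltr_pdivrMr// => /andP[].
Qed.

Lemma qs_sum (R : realType) (s : R) (n : nat) (c : 'I_n -> rat * rat) :
  \sum_i qs s (c i) = qs s (\sum_i (c i).1, \sum_i (c i).2).
Proof. by rewrite /qs /= !rmorph_sum /= mulr_suml big_split. Qed.

Lemma cuttable_indefinite (R : realType) (p : rat) (s : R) (n : nat)
    (a b : 'I_n -> rat) (x : 'I_n -> R) (i j : 'I_n) (l : rat * rat) :
  0 < s -> s ^+ 2 = ratr p -> (forall i, x i = ratr (a i) + ratr (b i) * s) ->
  (forall i, 0 < x i) ->
  0 < ratr (a i) - ratr (b i) * s -> ratr (a j) - ratr (b j) * s < 0 ->
  0 < qs s l -> cuttable x setT (qs s l).
Proof.
move=> s0 sp xE x0 conj_i conj_j z0.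
have cutx k : cuttable x set0 (x k).
  exact: cuttableW (@sub0set _ _) (cuttable_piece (i := k)).
(* [x i] plus its positive conjugate is the rational 2 * a i; below, [x j] minus its negative
   conjugate is 2 * b j * s. *)
have cut1 : cuttable x set0 1.
  have a0 : 0 < a i by rewrite -(ltr0q R); have := x0 i; rewrite xE; lra.
  have conj_cut : cuttable x set0 (ratr (a i) - ratr (b i) * s).
    apply: (cuttable_conj (q := a i ^+ 2 - p * b i ^+ 2)) (cutx i) => //.
    by rewrite xE rmorphB rmorphXn rmorphM rmorphXn /= -sp; ring.
  have := cuttableD (x0 i) conj_i (cutx i) conj_cut; rewrite setUid.
  move/(cuttableZ (q := (a i *+ 2)^-1)).
  have -> : ratr (a i *+ 2)^-1 * (x i + (ratr (a i) - ratr (b i) * s)) = 1.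
    rewrite xE (_ : _ + (_ - _) = ratr (a i *+ 2)); last by rewrite rmorphMn /=; ring.
    by rewrite fmorphV mulVf// fmorph_eq0 gt_eqF ?pmulrn_lgt0.
  by apply; [exact: addr_gt0 (x0 i) conj_i|rewrite invr_gt0 pmulrn_lgt0].
have cuts : cuttable x set0 s.
  have b0 : 0 < b j.
    rewrite -(ltr0q R) -(pmulr_lgt0 _ s0).
    by have := x0 j; rewrite xE; lra.
  have conj_j' : 0 < ratr (b j) * s - ratr (a j) by rewrite -oppr_lt0 opprB.
  have conj_cut : cuttable x set0 (ratr (b j) * s - ratr (a j)).
    apply: (cuttable_conj (q := p * b j ^+ 2 - a j ^+ 2)) (cutx j) => //.
    by rewrite xE rmorphB rmorphXn rmorphM rmorphXn /= -sp; ring.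
  have := cuttableD (x0 j) conj_j' (cutx j) conj_cut; rewrite setUid.
  move/(cuttableZ (q := (b j *+ 2)^-1)).
  have -> : ratr (b j *+ 2)^-1 * (x j + (ratr (b j) * s - ratr (a j))) = s.
    rewrite xE (_ : _ + (_ - _) = ratr (b j *+ 2) * s); last by rewrite rmorphMn /=; ring.
    by rewrite fmorphV mulKf// fmorph_eq0 gt_eqF ?pmulrn_lgt0.
  by apply; [exact: addr_gt0 (x0 j) conj_j'|rewrite invr_gt0 pmulrn_lgt0].
have [q [q0 qz _]] := small_ratr (\sum_i x i) 0 z0 ltr01.
have w0 : 0 < qs s l - ratr q * \sum_i x i by rewrite subr_gt0.
apply: (cuttable_diverse q0 w0 x0).
have xqs k : x k = qs s (a k, b k) by rewrite xE.
have wE : qs s l - ratr q * \sum_i x i =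
    qs s (l.1 - q * \sum_i a i, l.2 - q * \sum_i b i).
  under eq_bigr do rewrite xqs.
  by rewrite qs_sum /qs /= !rmorphB !rmorphM /=; ring.
by rewrite wE; rewrite wE in w0; exact: cuttable_field sp cut1 cuts w0.
Qed.

(** The squared form is the one in which the bound comes out of the discriminant. *)
Lemma ltr_norm_ratio (F : realFieldType) (a b e f : F) : 0 < a -> 0 < e ->
  (`|b| / a < `|f| / e) = (b ^+ 2 * e ^+ 2 < f ^+ 2 * a ^+ 2).
Proof.
move=> a0 e0; rewrite ltr_pdivrMr// mulrAC ltr_pdivlMr//.
rewrite -(ltr_pXn2r (n := 2))// ?nnegrE ?mulr_ge0// ?(ltW a0) ?(ltW e0)//.
by rewrite !exprMn !real_normK ?num_real.
Qed.

(** * Both definite cases at once *)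

Section DefiniteCase.
Variables (R : realType) (n : nat) (p : rat) (s al be : R).
Hypotheses (hn : (2 <= n)%N) (s0 : 0 < s) (irr : irrational s).
Hypothesis (sp : s ^+ 2 = ratr p).
(** Positive conjugates correspond to (1, s), negative ones to (s, 1): exchanging the coordinates
    turns one case into the other. *)
Hypothesis (albe : al = 1 /\ be = s \/ al = s /\ be = 1).
Variables (a b : 'I_n -> rat) (x : 'I_n -> R).
Hypothesis hx : forall i, x i = ratr (a i) * al + ratr (b i) * be.
Hypothesis hx0 : forall i, 0 < x i.
Hypothesis hx' : forall i, 0 < ratr (a i) * al - ratr (b i) * be.
Hypothesis hdiv : forall i j, i != j -> irrational (x i / x j).
Hypothesis hmul : forall i j, i != j -> irrational (x i * x j).

Let al0 : 0 < al. Proof. by case: albe => -[-> _]. Qed.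
Let be0 : 0 < be. Proof. by case: albe => -[_ ->]. Qed.

Let squares : exists pa pb : rat, al ^+ 2 = ratr pa /\ be ^+ 2 = ratr pb.
Proof.
by case: albe => -[-> ->]; [exists 1, p|exists p, 1]; rewrite sp rmorph1 expr1n.
Qed.

Let a_gt0 i : 0 < a i.
Proof.
rewrite -(ltr0q R) -(pmulr_lgt0 _ al0).
by have := hx0 i; have := hx' i; rewrite hx; lra.
Qed.

(** If b i / a i and b j / a j were equal, x i / x j would be rational; if they were opposite, x i *
    x j would be. *)
Lemma definite_ratio_inj i j : i != j -> `|b i| / a i != `|b j| / a j.
Proof.
move=> ij; apply/eqP => E; have [pa [pb [ala beb]]] := squares.
have [aiN0 ajN0] := (lt0r_neq0 (a_gt0 i), lt0r_neq0 (a_gt0 j)).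
have : `|b i / a i| = `|b j / a j|.
  by rewrite !normf_div !(gtr0_norm (a_gt0 _)).
have bE k : ratr (b k) = ratr (b k / a k) * ratr (a k) :> R.
  by rewrite -rmorphM /= divfK ?gt_eqF.
move/eqP; rewrite eqr_norm2 => /orP[]/eqP D.
- apply: (hdiv ij); exists (a i / a j) => //.
  rewrite !hx (bE i) (bE j) D fmorph_div /=.
  have tj := hx0 j; rewrite hx (bE j) in tj.
  set t := ratr (b j / a j) in tj *.
  have -> : ratr (a i) * al + t * ratr (a i) * be = ratr (a i) * (al + t * be).
    by ring.
  have E2 : ratr (a j) * al + t * ratr (a j) * be = ratr (a j) * (al + t * be).
    by ring.
  rewrite E2 in tj *.
  have tN0 : al + t * be != 0 by apply: contraTneq tj => ->; rewrite mulr0 ltxx.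
  by rewrite -[RHS]mulf_div (divff tN0) mulr1.
- apply: (hmul ij); exists (a i * a j * (pa - (b j / a j) ^+ 2 * pb)) => //.
  rewrite !hx (bE i) (bE j) D rmorphN.
  by rewrite !rmorphM rmorphB !rmorphM ?rmorphXn /= -ala -beb; ring.
Qed.

Lemma definite_sufficient (e f : rat) (i : 'I_n) :
  0 < e -> `|f| / e < `|b i| / a i -> cuttable x setT (ratr e * al + ratr f * be).
Proof.
move=> e0 D; have [pa [pb [ala beb]]] := squares.
pose x' := ratr (a i) * al - ratr (b i) * be.
have x'0 : 0 < x' by exact: hx'.
have aN0 := lt0r_neq0 (a_gt0 i).
have bN0 : b i != 0.
  by apply: contraTneq D => ->; rewrite normr0 mul0r -leNgt divr_ge0// ltW.
have cutx : cuttable x set0 (x i).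
  exact: cuttableW (@sub0set _ _) (cuttable_piece (i := i)).
have cutx' : cuttable x set0 x'.
  apply: (cuttable_conj (q := a i ^+ 2 * pa - b i ^+ 2 * pb)) cutx => //.
  by rewrite hx /x' rmorphB !rmorphM ?rmorphXn /= -ala -beb; ring.
(* [cf] and [cf'] are the coordinates in the basis [x i], [x']. The bound on |f| / e says that both
   are positive for (e, f), and this survives subtracting a small multiple of the sum. *)
pose cf g h := (g / a i + h / b i) / 2.
pose cf' g h := (g / a i - h / b i) / 2.
have decomp g h :
    ratr g * al + ratr h * be = ratr (cf g h) * x i + ratr (cf' g h) * x'.
  have gE : ratr g = ratr (g / a i) * ratr (a i) :> R.
    by rewrite -rmorphM /= divfK.
  have hE : ratr h = ratr (h / b i) * ratr (b i) :> R.
    by rewrite -rmorphM /= divfK.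
  rewrite gE hE hx /x' [ratr (cf _ _)]fmorph_div [ratr (cf' _ _)]fmorph_div.
  rewrite rmorphD rmorphB /= ratr_nat.
  by move: (ratr (g / a i)) (ratr (h / b i)) => u v; field.
have D' : `|f / b i| < e / a i.
  rewrite normf_div ltr_pdivrMr ?normr_gt0// mulrAC ltr_pdivlMr//.
  by move: D; rewrite ltr_pdivrMr// mulrAC ltr_pdivlMr// mulrC [e * _]mulrC.
have [c0 c'0] : 0 < cf e f /\ 0 < cf' e f.
  by rewrite /cf /cf'; move: D'; rewrite ltr_norml => /andP[]; split; lra.
pose sa := \sum_j a j; pose sb := \sum_j b j.
have sumE : \sum_j x j = ratr sa * al + ratr sb * be.
  by rewrite !rmorph_sum /= !mulr_suml -big_split; apply: eq_bigr.
rewrite -(ltr0q R) in c0; rewrite -(ltr0q R) in c'0.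
have [q [q0 qc qc']] := small_ratr (ratr (cf sa sb)) (ratr (cf' sa sb)) c0 c'0.
rewrite -rmorphM -subr_gt0 -rmorphB ltr0q /= in qc.
rewrite -rmorphM -subr_gt0 -rmorphB ltr0q /= in qc'.
have wE : ratr e * al + ratr f * be - ratr q * \sum_j x j =
    ratr (cf e f - q * cf sa sb) * x i + ratr (cf' e f - q * cf' sa sb) * x'.
  rewrite sumE !decomp [ratr (cf e f - _)]rmorphB [ratr (cf' e f - _)]rmorphB.
  by rewrite !rmorphM /=; ring.
have w0 : 0 < ratr e * al + ratr f * be - ratr q * \sum_j x j.
  by rewrite wE addr_gt0// mulr_gt0// ltr0q.
apply: (cuttable_diverse q0 w0 hx0 (S := set0)).
by rewrite wE; rewrite wE in w0; apply: cuttable_comb => //; exact: ltW.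
Qed.

Lemma definite_necessary (Q : rect R) (z : R) : side_ratio Q z ->
  diversely_tileable x Q -> exists e f : rat,
    [/\ z = ratr e * al + ratr f * be, 0 < z, 0 < e &
        `|f| / e < \big[Num.max/0]_(i < n) (`|b i| / a i)].
Proof.
move=> Qz [m [T [tQ Tx xT]]].
(* [c] and [mk] translate between coordinates over (al, be) and over (1, s); in the swapped case
   [eps] is -1. *)
have [eps [c [mk [eps1 cE c'E]]]] : exists eps (c : 'I_n -> rat * rat)
    (mk : rat * rat -> rat * rat),
    [/\ eps ^+ 2 = 1,
      forall i, x i = qs s (c i) /\
        eps * qs (- s) (c i) = ratr (a i) * al - ratr (b i) * be &
      forall l, qs s l = ratr (mk l).1 * al + ratr (mk l).2 * be /\
        eps * qs (- s) l = ratr (mk l).1 * al - ratr (mk l).2 * be].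
  case: albe => -[alE beE].
  - exists 1, (fun i => (a i, b i)), id; split; first by rewrite expr1n.
      by move=> i; rewrite hx alE beE /qs /=; split; ring.
    by move=> l; rewrite alE beE /qs /=; split; ring.
  - exists (- 1), (fun i => (b i, a i)), (fun l => (l.2, l.1)).
    split; first by rewrite sqrrN expr1n.
      by move=> i; rewrite hx alE beE /qs /=; split; ring.
    by move=> l; rewrite alE beE /qs /=; split; ring.
have irr' : irrational (- s).
  by move=> [q _ qs]; apply: irr; exists (- q) => //; rewrite rmorphN /= qs opprK.
have sp' : (- s) ^+ 2 = ratr p by rewrite sqrrN.
have Tx' k : exists i, side_ratio (T k) (qs s (c i)).
  by have [i Ti] := Tx k; exists i; rewrite -(cE i).1.
have [l zE] : exists l, z = qs s l.
  by apply: tiled_ratio_in_field irr sp tQ Qz _ => k; have [i] := Tx' k; exists (c i).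
have z0 := side_ratio_gt0 Qz; rewrite zE in Qz.
have x'0 i : 0 < eps * qs (- s) (c i) by rewrite (cE i).2.
have z'0 := tiled_conj_gt0 irr irr' sp sp' eps1 x'0 tQ Qz Tx'.
have disc i := tiled_disc irr irr' sp sp' eps1 x'0 tQ Qz Tx' (i0 := i).
have [zE1 z'E] := c'E l; rewrite zE1 in zE.
set e := (mk l).1 in zE zE1 z'E; set f := (mk l).2 in zE zE1 z'E.
have e0 : 0 < e.
  rewrite -(ltr0q R) -(pmulr_lgt0 _ al0).
  by move: z0 z'0; rewrite zE z'E; lra.
exists e, f; split => //.
have discE i : (qs s l + eps * qs (- s) l) ^+ 2 * (qs s (c i) * (eps * qs (- s) (c i)))
    - qs s l * (eps * qs (- s) l) * (qs s (c i) + eps * qs (- s) (c i)) ^+ 2 =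
    4 * (al * be) ^+ 2 * ratr (f ^+ 2 * a i ^+ 2 - b i ^+ 2 * e ^+ 2).
  rewrite -(cE i).1 (cE i).2 zE1 z'E hx rmorphB !rmorphM ?rmorphXn /=.
  by ring.
have lead0 : 0 < 4 * (al * be) ^+ 2 by rewrite mulr_gt0// exprn_gt0// mulr_gt0.
rewrite ltNge; apply/negP => /bigmax_leP[_ le_max].
(* Of two distinct ratios bounded by |f| / e, at least one is strictly smaller; this is the tile
   ratio on which the form is positive. *)
have [i0 i0_lt] : exists i0, `|b i0| / a i0 < `|f| / e.
  pose o0 := Ordinal (ltnW hn); pose o1 := Ordinal hn.
  have := le_max o0 isT; rewrite le_eqVlt => /orP[/eqP E0|]; last by exists o0.
  have := le_max o1 isT; rewrite le_eqVlt => /orP[/eqP E1|]; last by exists o1.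
  by have /negP[] := definite_ratio_inj (i := o0) (j := o1) isT; rewrite E0 E1.
have [||i] := disc i0.
- by have [k] := xT i0; rewrite (cE i0).1 => Tk; exists k.
- rewrite -subr_gt0 discE pmulr_rgt0// ltr0q subr_gt0.
  by rewrite -ltr_norm_ratio.
- rewrite -subr_lt0 discE pmulr_rlt0// ltrq0 subr_lt0 -ltr_norm_ratio//.
  by rewrite ltNge le_max.
Qed.

Lemma definite_tileable (Q : rect R) (z : R) : side_ratio Q z ->
  diversely_tileable x Q <-> exists e f : rat,
    [/\ z = ratr e * al + ratr f * be, 0 < z, 0 < e &
        `|f| / e < \big[Num.max/0]_(i < n) (`|b i| / a i)].
Proof.
move=> Qz; split; first exact: definite_necessary.
(* The default 0 of the maximum cannot exceed |f| / e, so some index does. *)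
move=> [e [f [zE _ e0 /bigmax_gtP[|[i _ fe]]]]].
  by rewrite ltNge divr_ge0// ltW.
have [|m [T [tQ Tx xT]]] := definite_sufficient e0 fe (Q := Q); first by rewrite -zE.
by exists m, T; split => // j; exact: xT.
Qed.

End DefiniteCase.

(* MathComp world (MathComp-Analysis).  In parts 2 and 3 the hypotheses force
   a i > 0, resp. b i > 0, so the quotients in the maximum are nonnegative and
   the neutral element 0 of the iterated maximum is harmless. *)
Theorem theorem2 (R : realType) (n : nat) (hn : (2 <= n)%N) (p : rat)
    (a b : 'I_n -> rat) (x : 'I_n -> R)
    (hx : forall i, x i = ratr (a i) + ratr (b i) * Num.sqrt (ratr p))
    (hx0 : forall i, 0 < x i)
    (hdiv : forall i j, i != j -> irrational (x i / x j))
    (hmul : forall i j, i != j -> irrational (x i * x j))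
    (z : R) (hz : 0 < z) (Q : rect R) (hQ : side_ratio Q z) :
  [/\ (exists i j,
         (ratr (a i) - ratr (b i) * Num.sqrt (ratr p)) *
         (ratr (a j) - ratr (b j) * Num.sqrt (ratr p)) < 0 :> R) ->
      (diversely_tileable x Q <->
       exists e f : rat, z = ratr e + ratr f * Num.sqrt (ratr p) /\ 0 < z),
      (forall i, 0 < ratr (a i) - ratr (b i) * Num.sqrt (ratr p) :> R) ->
      (diversely_tileable x Q <->
       exists e f : rat,
         [/\ z = ratr e + ratr f * Num.sqrt (ratr p), 0 < z, 0 < e &
             `|f| / e < \big[Num.max/0]_(i < n) (`|b i| / a i)]) &
      (forall i, ratr (a i) - ratr (b i) * Num.sqrt (ratr p) < 0 :> R) ->
      (diversely_tileable x Q <->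
       exists e f : rat,
         [/\ z = ratr e + ratr f * Num.sqrt (ratr p), 0 < z, 0 < f &
             `|e| / f < \big[Num.max/0]_(i < n) (`|a i| / b i)])].
Proof.
set s : R := Num.sqrt (ratr p) in hx *.
(* A rational root would make the quotient of the first two ratios rational. This also excludes p <=
   0, where [Num.sqrt] returns 0. *)
have irr : irrational s.
  move=> [r _ rs]; pose o0 := Ordinal (ltnW hn); pose o1 := Ordinal hn.
  apply: (@hdiv o0 o1) => //.
  exists ((a o0 + b o0 * r) / (a o1 + b o1 * r)) => //.
  by rewrite !hx -rs fmorph_div !rmorphD !rmorphM.
have sN0 : s != 0 by apply/eqP => E; apply: irr; exists 0 => //; rewrite rmorph0.
have s0 : 0 < s by rewrite lt_neqAle eq_sym sN0 sqrtr_ge0.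
have sp : s ^+ 2 = ratr p by rewrite sqr_sqrtr// ltW// -sqrtr_gt0.
split.
- move=> [i [j ij]]; split.
    move=> [m [T [tQ Tx _]]].
    have [|[e f] zE] := tiled_ratio_in_field irr sp tQ hQ.
      by move=> k; have [i1] := Tx k; exists (a i1, b i1); rewrite /qs -hx.
    by exists e, f.
  move=> [e [f [zE _]]].
  have [i' [j' [hi hj]]] : exists i' j',
      0 < ratr (a i') - ratr (b i') * s /\ ratr (a j') - ratr (b j') * s < 0.
    move: ij; have [ui|ui|->] := ltgtP (ratr (a i) - ratr (b i) * s) 0.
    - by rewrite nmulr_rlt0// => uj; exists j, i.
    - by rewrite pmulr_rlt0// => uj; exists i, j.
    - by rewrite mul0r ltxx.
  have z0 : 0 < qs s (e, f) by rewrite /qs /= -zE.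
  have := cuttable_indefinite s0 sp hx hx0 hi hj z0.
  rewrite /qs /= -zE => /(_ Q hQ)[m [T [tQ Tx xT]]].
  by exists m, T; split => // o; exact: xT.
- move=> hx'.
  have hx1 i : x i = ratr (a i) * 1 + ratr (b i) * s by rewrite mulr1 hx.
  have hx1' i : 0 < ratr (a i) * 1 - ratr (b i) * s by rewrite mulr1.
  have albe : 1 = 1 :> R /\ s = s \/ 1 = s /\ s = 1 by left.
  apply: iff_trans
    (definite_tileable hn s0 irr sp albe hx1 hx0 hx1' hdiv hmul hQ) _.
  by split=> -[e [f [zE z0 e0 fe]]]; exists e, f; rewrite ?mulr1 in zE *.
- move=> hx'.
  have hx1 i : x i = ratr (b i) * s + ratr (a i) * 1 by rewrite mulr1 hx addrC.
  have hx1' i : 0 < ratr (b i) * s - ratr (a i) * 1.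
    by rewrite mulr1 -oppr_lt0 opprB.
  (* Here [b] plays the part of [a]: the opposite of the conjugate is b i * s - a i. *)
  have albe : s = 1 /\ 1 = s \/ s = s /\ 1 = 1 :> R by right.
  apply: iff_trans
    (definite_tileable hn s0 irr sp albe hx1 hx0 hx1' hdiv hmul hQ) _.
  split=> -[e [f [zE z0 e0 fe]]]; exists f, e; split => //.
    by rewrite zE mulr1 addrC.
  by rewrite zE mulr1 addrC.
Qed.
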